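(* Let $\mathfrak{S} = (S, \vee)$ be a downward directed semilattice, and let $\mathrm{Con}(\mathfrak{S})$ be the lattice of congruences on $\mathfrak{S}$. Then there is a local clone $\mathcal{C}_2$ on the set $S$ such that $[\mathcal{C}_2, \mathcal{O}_S] \simeq \mathrm{Con}(\mathfrak{S})$; that is, there is a lattice isomorphism between the set of local clones on $S$ containing $\mathcal{C}_2$ (ordered by inclusion) and the set of congruences of $\mathfrak{S}$ (ordered by inclusion).
   Context: $S$ is a nonempty set. $\mathcal{O}_S^{(n)}$ is the set of all functions $S^n \to S$ ($n \ge 1$), and $\mathcal{O}_S = \bigcup_{n\ge 1} \mathcal{O}_S^{(n)}$ is the full clone on $S$. A clone on $S$ is a set $\mathcal{C} \subseteq \mathcal{O}_S$ which contains all projections and is closed under composition. A clone $\mathcal{C}$ is a local clone if for every $k \ge 1$ the set $\mathcal{C} \cap \mathcal{O}_S^{(k)}$ is closed in the product topology on $S^{S^k}$ ($S$ discrete); equivalently: whenever $f \in \mathcal{O}_S^{(k)}$ and for every finite $A \subseteq S^k$ there is $g \in \mathcal{C} \cap \mathcal{O}_S^{(k)}$ with $g|_A = f|_A$, then $f \in \mathcal{C}$. The local clones on $S$ form a complete lattice under inclusion with largest element $\mathcal{O}_S$; $[\mathcal{C}_2,\mathcal{O}_S]$ denotes the interval of this lattice consisting of all local clones containing $\mathcal{C}_2$. A semilattice $(S, \vee)$ is ordered by $x \le y \Leftrightarrow x \vee y = y$; it is downward directed if any two elements have a common lower bound. A congruence on $(S,\vee)$ is an equivalence relation on $S$ compatible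 with $\vee$. *)

(* Defs.v *)
From HB Require Import structures.
From mathcomp Require Import all_boot all_order.
From mathcomp Require Import all_classical.
#[warning="-warn-library-file-internal-analysis"]
From mathcomp Require Import topology.

Set Implicit Arguments.
Unset Strict Implicit.
Unset Printing Implicit Defensive.

Import Order.TTheory.
Local Open Scope classical_set_scope.

(* A closure system on T, i.e. a family of subsets of T stable under arbitrary
   intersections (the empty one, setT, included). Its members, ordered by
   inclusion, form a lattice: the meet is the intersection and the join is the
   smallest member containing the union. *)
Record closureSystem (T : Type) := ClosureSystem {
  cs_family : set (set T);
  cs_bigcap : forall F : set (set T),
    F `<=` cs_family -> cs_family (\bigcap_(A in F) A)
}.

Record csMember (T : Type) (P : closureSystem T) := CsMember {
  cs_val :> set T;
  cs_valP : cs_family P cs_val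
}.

Section ClosureSystemLattice.
Context {T : Type} {P : closureSystem T}.
Implicit Types A B C : csMember P.

Lemma cs_val_inj A B : A = B :> set T -> A = B.
Proof.
case: A B => [A PA] [B PB] /= AB; rewrite AB in PA *.
by congr CsMember; exact: Prop_irrelevance.
Qed.

HB.instance Definition _ := gen_eqMixin (csMember P).
HB.instance Definition _ := gen_choiceMixin (csMember P).

Let cs_le A B := `[< A `<=` B >].

Let cs_le_refl : reflexive cs_le.
Proof. by move=> A; apply/asboolP. Qed.

Let cs_le_anti : antisymmetric cs_le.
Proof.
move=> A B /andP[/asboolP AB /asboolP BA].
by apply: cs_val_inj; apply/seteqP.
Qed.

Let cs_le_trans : transitive cs_le.
Proof.
move=> A B C /asboolP BA /asboolP AC; apply/asboolP.
exact: subset_trans BA AC.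
Qed.

HB.instance Definition _ := Order.Le_isPOrder.Build set_display (csMember P)
  cs_le_refl cs_le_anti cs_le_trans.

Lemma cs_leE A B : (A <= B)%O = `[< A `<=` B >].
Proof. by []. Qed.

Lemma cs_setT : cs_family P setT.
Proof. by rewrite -(bigcap_set0 id); apply: cs_bigcap. Qed.

Lemma cs_setI A B : cs_family P (A `&` B).
Proof.
rewrite -(bigcap2E (cs_val A) (cs_val B)) -(bigcap_image setT _ id).
apply: cs_bigcap => _ [[|[|n]] _ <-] /=; [exact: cs_valP|exact: cs_valP|].
exact: cs_setT.
Qed.

Lemma cs_smallest (X : set T) : cs_family P (smallest (cs_family P) X).
Proof. by apply: cs_bigcap => A []. Qed.

Let cs_meet A B := CsMember (cs_setI A B).
Let cs_join A B := CsMember (cs_smallest (A `|` B)).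

Let cs_meetP A B C : (A <= cs_meet B C)%O = (A <= B)%O && (A <= C)%O.
Proof.
apply/asboolP/andP => /= [|[/asboolP AB /asboolP AC]]; last by rewrite subsetI.
by rewrite subsetI => -[? ?]; split; apply/asboolP.
Qed.

Let cs_joinP A B C : (cs_join A B <= C)%O = (A <= C)%O && (B <= C)%O.
Proof.
apply/asboolP/andP => /= [sC|[/asboolP AC /asboolP BC]]; last first.
  by apply: smallest_sub; [exact: cs_valP|rewrite subUset].
have : A `|` B `<=` C by apply: subset_trans sC; exact: sub_gen_smallest.
rewrite subUset => -[AC BC].
by split; apply/asboolP.
Qed.

HB.instance Definition _ := Order.POrder_MeetJoin_isLattice.Build
  set_display (csMember P) cs_meetP cs_joinP.

Let cs_top := CsMember cs_setT.

Let cs_lex1 A : (A <= cs_top)%O.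
Proof. by apply/asboolP. Qed.

HB.instance Definition _ := Order.hasTop.Build set_display (csMember P) cs_lex1.

Lemma cs_meetE A B : (A `&` B)%O = A `&` B :> set T.
Proof. by []. Qed.

Lemma cs_joinE A B : (A `|` B)%O = smallest (cs_family P) (A `|` B) :> set T.
Proof. by []. Qed.

Lemma cs_topE : (\top%O : csMember P) = setT :> set T.
Proof. by []. Qed.

End ClosureSystemLattice.

Definition latticeInterval d (L : latticeType d) (a b : L) : Type :=
  {x : L | (a <= x <= b)%O}.

Section LatticeInterval.
Context {d : Order.disp_t} {L : latticeType d} (a b : L).

HB.instance Definition _ := SubChoice.on (latticeInterval a b).

Let itv := [pred x : L | (a <= x <= b)%O].

Let itv_meet_closed : Order.ClosedPredicates.meet_closed itv.
Proof.
move=> x y /andP[ax xb] /andP[ay yb]; rewrite inE lexI ax ay /=.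
exact: le_trans (leIl x y) xb.
Qed.

Let itv_join_closed : Order.ClosedPredicates.join_closed itv.
Proof.
move=> x y /andP[ax xb] /andP[ay yb]; rewrite inE leUx xb yb !andbT.
exact: le_trans ax (leUl x y).
Qed.

HB.instance Definition _ := Order.SubChoice_isSubLattice.Build d L
  (fun x : L => (a <= x <= b)%O) d (latticeInterval a b)
  itv_meet_closed itv_join_closed.

End LatticeInterval.

(* The second component of an operation with first component n has arity n.+1,
   so that arities are at least 1. *)
Definition operation (S : Type) : Type := {n : nat & ('I_n.+1 -> S) -> S}.

Definition opn (S : Type) (n : nat) (f : ('I_n.+1 -> S) -> S) : operation S :=
  existT _ n f.

Definition is_clone (S : Type) (C : set (operation S)) : Prop :=
  (forall (n : nat) (i : 'I_n.+1), C (opn (fun x : 'I_n.+1 -> S => x i))) /\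
  (forall (n m : nat) (f : ('I_n.+1 -> S) -> S)
          (g : 'I_n.+1 -> ('I_m.+1 -> S) -> S),
    C (opn f) -> (forall i, C (opn (g i))) ->
    C (opn (fun x : 'I_m.+1 -> S => f (fun i => g i x)))).

Definition is_local_clone (S : choiceType) (C : set (operation S)) : Prop :=
  is_clone C /\
  forall n : nat,
    closed ([set f | C (opn f)]
              : set {ptws ('I_n.+1 -> S) -> discrete_topology S}).

Section LocalClones.
Context {S : choiceType}.
Implicit Types (C : set (operation S)) (n : nat).

Lemma is_local_cloneP C : is_local_clone C <->
  is_clone C /\
  forall n (f : ('I_n.+1 -> S) -> S),
    (forall A : set ('I_n.+1 -> S), finite_set A ->
       exists2 g, C (opn g) & forall x, A x -> g x = f x) ->
    C (opn f).
Proof.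
split=> -[cC lC]; split=> // n.
  move=> f appr; apply: (lC n f).
  pose F : set_system {ptws ('I_n.+1 -> S) -> discrete_topology S} :=
    [set B | exists2 A : set ('I_n.+1 -> S), finite_set A &
       forall g, (forall x, A x -> g x = f x) -> B g].
  have FF : Filter F.
    split=> [|B1 B2 [A1 fA1 AB1] [A2 fA2 AB2]|B1 B2 B12 [A fA AB1]].
    - by exists set0.
    - exists (A1 `|` A2); first by rewrite finite_setU.
      move=> g gf; split; [apply: AB1|apply: AB2] => x Ax; apply: gf;
        [by left|by right].
    - by exists A => // g /AB1 /B12.
  have Ff : F --> (f : {ptws ('I_n.+1 -> S) -> discrete_topology S}).
    apply/cvg_sup => x U [V] [[W oW <-] /= Wfx WU].
    exists [set x]; first exact: finite_set1.
    by move=> g gf; apply: WU; rewrite /= gf.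
  move=> B /Ff [A fA AB]; have [g Cg gf] := appr A fA.
  by exists g; split=> //; exact: AB.
move=> f cf; apply: lC => A fA.
suff /cf[g [Cg gf]] : nbhs f [set g : {ptws ('I_n.+1 -> S) ->
    discrete_topology S} | forall x, A x -> g x = f x] by exists g.
have -> : [set g | forall x, A x -> g x = f x] =
    \bigcap_(x in A) [set g : {ptws ('I_n.+1 -> S) -> discrete_topology S} |
                       g x = f x] by [].
have [s ->] := (finite_seqP A).1 fA.
rewrite bigcap_seq; elim/big_ind : _ => [|U V fU fV|x _].
- exact: filterT.
- exact: filterI.
- have /(_ f) := @proj_continuous _ (fun=> discrete_topology S) x.
  by move=> /(_ [set f x] (@discrete_set1 (discrete_topology S) (f x))).
Qed.

Lemma is_local_clone_bigcap (F : set (set (operation S))) :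
  F `<=` @is_local_clone S -> is_local_clone (\bigcap_(C in F) C).
Proof.
move=> lF; split; first split.
- by move=> n i C /lF[[pC _] _]; exact: pC.
- move=> n m f g Cf Cg C FC; have [[_ cC] _] := lF _ FC.
  by apply: cC => [|i]; [exact: Cf|exact: Cg].
- move=> n f cf C FC; apply: ((lF _ FC).2 n) => B /cf[g [Cg Bg]].
  by exists g; split=> //; exact: Cg.
Qed.

End LocalClones.

Definition local_clones (S : choiceType) : closureSystem (operation S) :=
  ClosureSystem (@is_local_clone_bigcap S).

Notation localClone S := (csMember (local_clones S)).

(* Equivalence relations are represented by their graphs. *)
Definition is_congruence d (S : joinSemilatticeType d) (r : set (S * S)) :
    Prop :=
  [/\ forall x, r (x, x),
      forall x y, r (x, y) -> r (y, x),
      forall x y z, r (x, y) -> r (y, z) -> r (x, z) &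
      forall x x' y y', r (x, x') -> r (y, y') ->
        r ((x `|` y)%O, (x' `|` y')%O)].

Lemma is_congruence_bigcap d (S : joinSemilatticeType d)
    (F : set (set (S * S))) :
  F `<=` @is_congruence d S -> is_congruence (\bigcap_(r in F) r).
Proof.
move=> cF; split.
- by move=> x r /cF[+ _ _ _]; apply.
- by move=> x y rxy r Fr; have [_ + _ _] := cF _ Fr; apply; exact: rxy.
- move=> x y z rxy ryz r Fr; have [_ _ rt _] := cF _ Fr.
  by apply: (rt x y z); [exact: rxy|exact: ryz].
- move=> x x' y y' rx ry r Fr; have [_ _ _ +] := cF _ Fr.
  by apply; [exact: rx|exact: ry].
Qed.

Definition congruences d (S : joinSemilatticeType d) : closureSystem (S * S) :=
  ClosureSystem (@is_congruence_bigcap d S).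

Notation congruence S := (csMember (congruences S)).

Definition downward_directed d (S : porderType d) : Prop :=
  forall x y : S, exists z : S, (z <= x)%O /\ (z <= y)%O.

(* Main.v *)
Require Import Defs.
From HB Require Import structures.
From mathcomp Require Import all_boot all_order.
From mathcomp Require Import all_classical.

(** Write [x <=_r c] when [x] lies below [c] in the quotient of [S] by a
    congruence [r].  To [r] corresponds the local clone of all operations that
    preserve every ideal [{x | x <=_r c}]; the diagonal congruence gives [C2],
    the operations bounded by the join of their arguments.  Conversely, let [C]
    be a local clone above [C2], and call [b] reachable from [a] if some unary
    operation of [C] maps [a] to [b]; this is [b <=_r a] for a congruence [r].
    If [x i = h_i c] with unary [h_i] in [C], composing with [f] in [C] yields
    [f x] from [c], so [C] preserves the ideals of [r].  If [f] preserves them,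
    then [f x] is reachable from the join of the arguments [x]; joining
    finitely many unary members of [C], evaluated at the join of the arguments,
    bounds [f] on a given finite set by a member [H] of [C]; everything below
    [H] is again in [C], being [g (H x) x] with [g] in [C2], so [f] is in [C] by
    local closedness. *)

Set Implicit Arguments.
Unset Strict Implicit.
Unset Printing Implicit Defensive.

Import Order.TTheory.
Local Open Scope classical_set_scope.
Local Open Scope order_scope.

(** Meets and joins are determined by the order: [g] is both left and right adjoint to [f], so [f]
    preserves both. *)
Lemma order_iso_lmorphism d (L : latticeType d) d' (L' : latticeType d')
    (f : L -> L') (g : L' -> L) :
    cancel f g -> cancel g f -> {mono f : x y / x <= y} ->
  exists phi : {lmorphism L -> L'}, bijective phi.
Proof.
move=> fK gK f_mono.
have f_homo : {homo f : x y / x <= y} by move=> x y; rewrite f_mono.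
have gf_le x y : (y <= f x) = (g y <= x) by rewrite -{1}[y]gK f_mono.
have fg_le x y : (f x <= y) = (x <= g y) by rewrite -{1}[y]gK f_mono.
have fI : {morph f : x y / x `&` y}.
  move=> x y; apply/le_anti/andP; split.
    by rewrite lexI !f_mono leIl leIr.
  by rewrite gf_le lexI -!gf_le leIl leIr.
have fU : {morph f : x y / x `|` y}.
  move=> x y; apply/le_anti/andP; split.
    by rewrite fg_le leUx -!fg_le leUl leUr.
  by rewrite leUx !f_mono leUl leUr.
pose fO := Order.isOrderMorphism.Build d L d' L' f f_homo.
pose fM := Order.isMeetLatticeMorphism.Build d L d' L' f fI.
pose fJ := Order.isJoinLatticeMorphism.Build d L d' L' f fU.
pose phi : {lmorphism L -> L'} := HB.pack f fO fM fJ.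
by exists phi; exists g.
Qed.

(** * The order of the quotient by a congruence *)

Section Quotient.
Context {d : Order.disp_t} {S : joinSemilatticeType d}.
Implicit Types r : set (S * S).

Definition quotient_le r (x y : S) : Prop := r (x `|` y, y).

Section Congruence.
Variables (r : set (S * S)) (cr : is_congruence r).

Lemma quotient_le_of_le x y : x <= y -> quotient_le r x y.
Proof.
by case: cr => rr _ _ _ xy; rewrite /quotient_le (join_r xy).
Qed.

Lemma quotient_le_trans y x z :
  quotient_le r x y -> quotient_le r y z -> quotient_le r x z.
Proof.
case: cr => rr rs rt rU xy yz.
(* The chain modulo [r] is [x \/ z ~ x \/ (y \/ z) ~ y \/ z ~ z]. *)
have : r (x `|` (y `|` z), y `|` z) by rewrite joinA; exact: rU.
move=> xyz; apply: (rt _ _ _ _ yz); apply: (rt _ _ _ _ xyz).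
  by apply: rU => //; exact: rs.
Qed.

Lemma quotient_leU x y z :
  quotient_le r x z -> quotient_le r y z -> quotient_le r (x `|` y) z.
Proof.
case: cr => rr rs rt rU xz yz.
have := rU _ _ _ _ xz yz; rewrite joinxx.
by rewrite joinACA joinxx.
Qed.

Lemma quotient_leP x y :
  r (x, y) <-> quotient_le r x y /\ quotient_le r y x.
Proof.
case: cr => rr rs rt rU; split=> [xy|[xy yx]].
  split.
    by have := rU _ _ _ _ xy (rr y); rewrite joinxx.
  by have := rU _ _ _ _ (rs _ _ xy) (rr x); rewrite joinxx.
by apply: rt xy; rewrite joinC; exact: rs.
Qed.

End Congruence.

(** * Clones preserving the ideals of a congruence *)

Definition ideal_clone r : set (operation S) :=
  [set o | let: existT n f := o in forall c (x : 'I_n.+1 -> S),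
     (forall i, quotient_le r (x i) c) -> quotient_le r (f x) c].

(** Preservation is tested on one argument tuple at a time, so approximation on singletons already
    suffices. *)
Lemma ideal_clone_local r : is_local_clone (ideal_clone r).
Proof.
apply/is_local_cloneP; split; first split=> //=.
- by move=> n m f g Cf Cg c x xc; apply: Cf => i; apply: Cg.
- move=> n f appr c x xc.
  have [g Cg gf] := appr [set x] (finite_set1 x).
  by rewrite /= -(gf x)//; exact: Cg.
Qed.

Definition reachable (C : set (operation S)) (a b : S) : Prop :=
  exists2 f : ('I_1 -> S) -> S, C (opn f) & f (fun=> a) = b.

Definition clone_congruence (C : set (operation S)) : set (S * S) :=
  [set p | reachable C p.1 p.2 /\ reachable C p.2 p.1].

Lemma reachable_ideal_clone r a b : is_congruence r ->
  reachable (ideal_clone r) a b <-> quotient_le r b a.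
Proof.
move=> cr; split=> [[f Cf <-]|ba].
  by apply: Cf => i /=; exact: quotient_le_of_le.
(* This operation moves only [a]; an ideal containing [a] also contains [b], by transitivity. *)
exists (fun x : 'I_1 -> S => if x ord0 == a then b else x ord0);
  last by rewrite eqxx.
move=> c x xc /=; case: eqP => // xa.
by apply: (quotient_le_trans cr ba); rewrite -xa.
Qed.

Lemma ideal_cloneK r :
  is_congruence r -> clone_congruence (ideal_clone r) = r.
Proof.
move=> cr; apply/seteqP; split=> -[x y] /=.
  by move=> [/reachable_ideal_clone yx /reachable_ideal_clone xy];
    apply/quotient_leP => //; split; [exact: xy|exact: yx].
by move=> /(quotient_leP cr)[xy yx]; split; apply/reachable_ideal_clone.
Qed.

Definition diagonal : set (S * S) := [set p | p.1 = p.2].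

Lemma diagonal_congruence : is_congruence diagonal.
Proof.
by rewrite /diagonal; split=> /= [x|x y ->|x y z -> ->|x x' y y' -> ->].
Qed.

Lemma quotient_le_diagonal x y : quotient_le diagonal x y <-> x <= y.
Proof. by rewrite /quotient_le /diagonal /= leEjoin; split=> /eqP. Qed.

(** [S] may lack a bottom, so the iteration starts from [x ord0], whose repetition is harmless by
    idempotence. *)
Definition joins n (x : 'I_n.+1 -> S) : S := \big[Order.join/x ord0]_i x i.

Lemma le_joins n (x : 'I_n.+1 -> S) i : x i <= joins x.
Proof.
rewrite /joins; have : i \in index_enum 'I_n.+1 by exact: mem_index_enum.
elim: index_enum => // j s IHs; rewrite inE big_cons => /predU1P[->|/IHs xs].
  exact: leUl.
exact: le_trans xs (leUr _ _).
Qed.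

Lemma quotient_le_joins r n (x : 'I_n.+1 -> S) c : is_congruence r ->
  (forall i, quotient_le r (x i) c) -> quotient_le r (joins x) c.
Proof.
move=> cr xc; rewrite /joins; elim/big_ind : _ => // y z.
exact: quotient_leU.
Qed.

(** In the quotient, [joins x] is the least bound of the arguments, so it is the only [c] to
    test. *)
Lemma ideal_cloneP r n (f : ('I_n.+1 -> S) -> S) : is_congruence r ->
  ideal_clone r (opn f) <-> forall x, quotient_le r (f x) (joins x).
Proof.
move=> cr; split=> [Cf x|fr c x xc].
  by apply: Cf => i; apply: quotient_le_of_le => //; exact: le_joins.
by apply: quotient_le_trans (fr x) _ => //; exact: quotient_le_joins.
Qed.

Lemma ideal_clone_homo r r' : is_congruence r -> is_congruence r' ->
  r `<=` r' -> ideal_clone r `<=` ideal_clone r'.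
Proof.
move=> cr cr' rr' [n f] /(ideal_cloneP f cr) fr.
by apply/(ideal_cloneP f cr') => x; apply: rr'; exact: fr.
Qed.

Lemma diagonal_cloneP n (f : ('I_n.+1 -> S) -> S) :
  ideal_clone diagonal (opn f) <-> forall x, f x <= joins x.
Proof.
rewrite (ideal_cloneP f diagonal_congruence).
by split=> fx x; apply/quotient_le_diagonal.
Qed.

Lemma diagonal_clone_sub r :
  is_congruence r -> ideal_clone diagonal `<=` ideal_clone r.
Proof.
move=> cr; apply: ideal_clone_homo => //; first exact: diagonal_congruence.
by case: cr => rr _ _ _ [x y]; rewrite /diagonal /= => ->.
Qed.

(** * Recovering a local clone from its congruence *)

Section CloneAboveDiagonal.
Variable C : set (operation S).
Hypotheses (lC : is_local_clone C) (C2C : ideal_clone diagonal `<=` C).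

Let clone_proj n i : C (opn (fun x : 'I_n.+1 -> S => x i)).
Proof. by case: lC => -[]. Qed.

Let clone_comp n m (f : ('I_n.+1 -> S) -> S)
    (g : 'I_n.+1 -> ('I_m.+1 -> S) -> S) :
  C (opn f) -> (forall i, C (opn (g i))) -> C (opn (fun x => f (g^~ x))).
Proof. by case: lC => -[_ +] _; apply. Qed.

Let clone_joins n : C (opn (@joins n)).
Proof. by apply/C2C/diagonal_cloneP. Qed.

Let clone_join n (f g : ('I_n.+1 -> S) -> S) :
  C (opn f) -> C (opn g) -> C (opn (fun x => f x `|` g x)).
Proof.
move=> Cf Cg; pose h (i : 'I_2) := if i == ord0 then f else g.
have Cj : C (opn (fun y : 'I_2 -> S => y ord0 `|` y ord_max)).
  by apply/C2C/diagonal_cloneP => y; rewrite leUx !le_joins.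
by apply: (clone_comp (g := h) Cj) => i; rewrite /h; case: ifP.
Qed.

Lemma clone_below n (f h : ('I_n.+1 -> S) -> S) :
  C (opn h) -> (forall x, f x <= h x) -> C (opn f).
Proof.
move=> Ch fh.
(* [G] lists [h] in slot 0, followed by the projections. *)
pose G i : ('I_n.+1 -> S) -> S :=
  if unlift ord0 i is Some j then fun x => x j else h.
(* The cutoff keeps [g] below its argument 0 on every tuple, hence in the clone of [diagonal]; at
   [(h x, x)] it is inactive. *)
pose g (z : 'I_n.+2 -> S) :=
  let y := f (fun j => z (lift ord0 j)) in
  if y <= z ord0 then y else z ord0.
have -> : f = fun x => g (G^~ x).
  apply/funext => x; rewrite /g /G unlift_none.
  have -> : (fun j : 'I_n.+1 => (if unlift ord0 (lift ord0 j) is Some k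
      then fun x : 'I_n.+1 -> S => x k else h) x) = x.
    by apply/funext => j; rewrite liftK.
  by rewrite fh.
apply: (clone_comp (f := g) (g := G)) => [|i]; last first.
  by rewrite /G; case: unlift => // j; exact: clone_proj.
apply/C2C/diagonal_cloneP => z; apply: le_trans (le_joins z ord0).
by rewrite /g; case: ifP.
Qed.

Lemma reachable_of_le a b : b <= a -> reachable C a b.
Proof.
move=> ba; exists (fun x : 'I_1 -> S => if x ord0 == a then b else x ord0).
  apply: (clone_below (clone_proj ord0)) => x.
  by case: eqP => // ->.
by rewrite eqxx.
Qed.

Lemma reachable_trans a b c :
  reachable C a b -> reachable C b c -> reachable C a c.
Proof.
move=> [f Cf fa] [g Cg gb]; exists (fun x => g (fun=> f x)).
  exact: (clone_comp (g := fun=> f)).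
by rewrite /= fa.
Qed.

Lemma reachable_join a b c :
  reachable C a b -> reachable C a c -> reachable C a (b `|` c).
Proof.
move=> [f Cf <-] [g Cg <-]; exists (fun x => f x `|` g x) => //.
exact: clone_join.
Qed.

(** For compatibility, descend from [x \/ y] to [x] and to [y], move on to [x'] and [y'], and join
    the results. *)
Lemma clone_congruence_is_congruence : is_congruence (clone_congruence C).
Proof.
split=> [x|x y [] |x y z [xy yx] [yz zy]|x x' y y' [/= xx' x'x] [/= yy' y'y]].
- by split; exact: reachable_of_le.
- by split.
- by split; [exact: reachable_trans xy yz|exact: reachable_trans zy yx].
- split; apply: reachable_join.
  + exact: reachable_trans (reachable_of_le (leUl _ _)) xx'.
  + exact: reachable_trans (reachable_of_le (leUr _ _)) yy'.
  + exact: reachable_trans (reachable_of_le (leUl _ _)) x'x.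
  + exact: reachable_trans (reachable_of_le (leUr _ _)) y'y.
Qed.

Lemma quotient_le_clone_congruence x y :
  quotient_le (clone_congruence C) x y <-> reachable C y x.
Proof.
split=> [[/= _ yxy]|yx].
  exact: reachable_trans yxy (reachable_of_le (leUl _ _)).
split=> /=; first exact: reachable_of_le (leUr _ _).
by apply: reachable_join => //; exact: reachable_of_le.
Qed.

Lemma clone_sub_ideal_clone : C `<=` ideal_clone (clone_congruence C).
Proof.
move=> [n f] Cf c x xc /=; apply/quotient_le_clone_congruence.
have /choice[h hP] i : exists h : ('I_1 -> S) -> S,
    C (opn h) /\ h (fun=> c) = x i.
  by have /quotient_le_clone_congruence[h Ch hc] := xc i; exists h.
exists (fun y => f (h^~ y)).
  by apply: (clone_comp (g := h)) => // i; case: (hP i).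
by congr f; apply/funext => i; case: (hP i).
Qed.

Lemma finite_upper_bound n (f : ('I_n.+1 -> S) -> S) (s : seq ('I_n.+1 -> S)) :
    ideal_clone (clone_congruence C) (opn f) ->
  exists2 h, C (opn h) & forall x, x \in s -> f x <= h x.
Proof.
move=> /(ideal_cloneP f clone_congruence_is_congruence) Cf.
(* For the empty list any member of [C] bounds [f]; a projection is at hand. *)
elim: s => [|a s [h Ch fh]]; first by exists (fun x => x ord0).
have /quotient_le_clone_congruence[g Cg ga] := Cf a.
(* The first term takes the value [f a] at [a]; the second bounds [f] on the rest of the list. *)
exists (fun x => g (fun=> joins x) `|` h x).
  by apply: clone_join => //; exact: (clone_comp (g := fun=> @joins n)).
move=> x; rewrite inE => /predU1P[->|/fh fx]; first by rewrite ga leUl.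
exact: le_trans fx (leUr _ _).
Qed.

Lemma ideal_clone_sub_clone : ideal_clone (clone_congruence C) `<=` C.
Proof.
move=> [n f] Cf; have /is_local_cloneP[_] := lC; apply=> A /finite_seqP[s ->].
have [h Ch fh] := finite_upper_bound s Cf.
(* Off [s], [f] may exceed [h]; truncating it there gives an operation below [h] everywhere that
   still agrees with [f] on [s]. *)
exists (fun x => if f x <= h x then f x else h x).
  by apply: (clone_below Ch) => x; case: ifP.
by move=> x /= /fh ->.
Qed.

Lemma clone_congruenceK : ideal_clone (clone_congruence C) = C.
Proof.
by apply/seteqP; split;
  [exact: ideal_clone_sub_clone|exact: clone_sub_ideal_clone].
Qed.

End CloneAboveDiagonal.

End Quotient.

Theorem theorem2p1 (d : Order.disp_t) (S : joinSemilatticeType d)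
    (S_nonempty : inhabited S) (S_directed : downward_directed S) :
  exists (C2 : localClone S)
         (phi : {lmorphism latticeInterval C2 (\top%O : localClone S)
                           -> congruence S}),
    bijective phi.
Proof.
pose C2 : localClone S :=
  @CsMember _ (local_clones S) _ (ideal_clone_local diagonal).
pose I := latticeInterval C2 (\top : localClone S).
have sub_I (C : I) : ideal_clone diagonal `<=` val C.
  by have /andP[/asboolP + _] := valP C.
pose f (C : I) : congruence S := @CsMember _ (congruences S) _
  (clone_congruence_is_congruence (cs_valP (val C)) (sub_I C)).
pose D (r : congruence S) : localClone S :=
  @CsMember _ (local_clones S) _ (ideal_clone_local r).
have D_I r : C2 <= D r <= \top.
  rewrite lex1 andbT; apply/asboolP.
  exact: diagonal_clone_sub (cs_valP r).
pose g r : I := exist _ (D r) (D_I r).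
exists C2; apply: (@order_iso_lmorphism _ _ _ _ f g).
- move=> C; apply/val_inj/cs_val_inj.
  exact: clone_congruenceK (cs_valP (val C)) (sub_I C).
- by move=> r; apply: cs_val_inj; exact: ideal_cloneK (cs_valP r).
- move=> B C; apply/asboolP/idP => [BC|].
    apply/asboolP.
    rewrite -[X in X `<=` _](clone_congruenceK (cs_valP (val B)) (sub_I B)).
    rewrite -[X in _ `<=` X](clone_congruenceK (cs_valP (val C)) (sub_I C)).
    exact: ideal_clone_homo (cs_valP (f B)) (cs_valP (f C)) BC.
  move=> /asboolP BC [x y] [/= [h Bh hx] [k Bk ky]].
  by split; [exists h|exists k] => //; exact: BC.
Qed.
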